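(* Let $\beta\ge1$, let $\alpha\in\mathbb{R}\setminus\mathbb{Q}$, and let $\frac pq\in\mathbb{Q}$ with $p\in\mathbb{Z}$, $q\in\mathbb{N}$, $\gcd(p,q)=1$. Let $(q_n)_n$ be the sequence of denominators of the convergents of $\alpha$. Then $$\mu_+\left(\alpha,\beta,\frac pq\right)=0\quad\left(\text{resp. }\mu_-\left(\alpha,\beta,\frac pq\right)=0\right)$$ if and only if $$\liminf_{n\to+\infty,\ q\mid q_{2n}}q_{2n}^{\beta}\cdot\{q_{2n}\alpha\}_2=0\quad\left(\text{resp. }\liminf_{n\to+\infty,\ q\mid q_{2n-1}}-q_{2n-1}^{\beta}\cdot\{q_{2n-1}\alpha\}_2=0\right).$$
   Context: For $x\in\mathbb{R}$, $\{x\}_2$ is the signed fractional part, the unique number in $[-\frac12,\frac12)$ with $x-\{x\}_2\in\mathbb{Z}$. For $\alpha\in\mathbb{R}\setminus\mathbb{Q}$, $\beta>0$, $\rho\in\mathbb{R}$ set $$\mu_+(\alpha,\beta,\rho)=\liminf_{k\to+\infty,\ \{k\alpha-\rho\}_2>0}k^\beta\{k\alpha-\rho\}_2,\qquad \mu_-(\alpha,\beta,\rho)=\liminf_{k\to+\infty,\ \{k\alpha-\rho\}_2<0}-k^\beta\{k\alpha-\rho\}_2 ,$$ with $k$ ranging over $\mathbb{N}=\{1,2,\dots\}$. With $\alpha=[a_0;a_1,a_2,\dots]$ the continued fraction expansion, the denominators of convergents are indexed by $q_0=1$, $q_1=a_1$, $q_{n+1}=a_{n+1}q_n+q_{n-1}$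 (so $\{q_n\alpha\}_2>0$ for even $n\ge2$ and $\{q_n\alpha\}_2<0$ for odd $n$). A liminf along an index set that is finite or empty is taken to be $+\infty$. *)

(* Defs.v *)
From HB Require Import structures.
From mathcomp Require Import all_boot all_order all_algebra.
From mathcomp Require Import all_classical all_reals all_analysis.
From mathcomp Require Import lra.

Set Implicit Arguments.
Unset Strict Implicit.
Unset Printing Implicit Defensive.

Import Order.TTheory GRing.Theory Num.Theory.
Import numFieldNormedType.Exports.

Local Open Scope classical_set_scope.
Local Open Scope ring_scope.

(* The representative of x modulo Z in [-1/2, 1/2[, see sfracP. *)
Definition sfrac (R : realType) (x : R) : R :=
  x - (Num.floor (x + 2^-1))%:~R.

Lemma sfracP (R : realType) (x y : R) :
  y = sfrac x <->
  [/\ - 2^-1 <= y, y < 2^-1 & exists m : int, x - y = m%:~R].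
Proof.
split=> [->|[y_ge y_lt [m xyE]]].
  have := floor_itv (x + 2^-1); rewrite intrD => /andP[fl_le fl_lt].
  split; last by exists (Num.floor (x + 2^-1)); rewrite /sfrac subKr.
  - by rewrite /sfrac; lra.
  - by rewrite /sfrac; lra.
have fl : Num.floor (x + 2^-1) = m.
  by apply/floor_def; rewrite intrD -xyE; apply/andP; split; lra.
by rewrite /sfrac fl -xyE subKr.
Qed.

(* Liminf of u n as n -> +oo with n restricted to P. *)
Definition liminf_on (R : realType) (P : set nat) (u : nat -> R) : \bar R :=
  limf_einf (fun n => (u n)%:E) (within P \oo).

(* The infimum of the empty set is +oo in \bar R. *)
Lemma liminf_on_finite (R : realType) (P : set nat) (u : nat -> R) :
  finite_set P -> liminf_on P u = +oo%E.
Proof.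
move=> finP; rewrite /liminf_on limf_einfE; apply/eqP; rewrite -leye_eq.
apply: ereal_sup_ubound; exists set0; last by rewrite image_set0 ereal_inf0.
have [N PN] : exists N, forall n, P n -> (n < N)%N.
  have /finite_seqP[s Ps] := finP.
  exists (\max_(i <- s) i).+1 => n; rewrite Ps /= => ns.
  by rewrite ltnS (leq_bigmax_seq (F := id)).
by exists N => // n /= Nn /PN; rewrite ltnNge Nn.
Qed.

Definition mu_plus (R : realType) (alpha beta rho : R) : \bar R :=
  liminf_on [set k : nat | (0 < k)%N /\ 0 < sfrac (k%:R * alpha - rho)]
    (fun k => k%:R `^ beta * sfrac (k%:R * alpha - rho)).

Definition mu_minus (R : realType) (alpha beta rho : R) : \bar R :=
  liminf_on [set k : nat | (0 < k)%N /\ sfrac (k%:R * alpha - rho) < 0]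
    (fun k => - (k%:R `^ beta * sfrac (k%:R * alpha - rho))).

(* Complete quotients of [a_0; a_1, a_2, ...], with a_n = floor of the n-th one.
   For irrational alpha the inverted fractional part is never 0. *)
Fixpoint cf_rem (R : realType) (alpha : R) (n : nat) : R :=
  if n is m.+1 then
    (cf_rem alpha m - (Num.floor (cf_rem alpha m))%:~R)^-1
  else alpha.

Definition cf_quot (R : realType) (alpha : R) (n : nat) : int :=
  Num.floor (cf_rem alpha n).

Fixpoint cf_den (R : realType) (alpha : R) (n : nat) : int :=
  if n is n'.+1 then
    if n' is n''.+1 then
      cf_quot alpha n * cf_den alpha n' + cf_den alpha n''
    else cf_quot alpha 1
  else 1.

(* Main.v *)
(* Put [K = q k], [P = p + q m] with [m] the integer nearest to [k alpha - p/q],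
   so that [K alpha - P = q {k alpha - p/q}].  If [k^beta |{k alpha - p/q}|] is
   small then so is [K |K alpha - P|], and by Legendre's criterion
   [(K, P) = d (q_n, p_n)]; as [P] is prime to [q], [q] divides [q_n], and the
   sign of the error fixes the parity of [n].  Conversely, if [q] divides [q_n],
   choose [1 <= d <= q] with [d p_n = p] modulo [q]; then [k = d q_n / q <= q_n]
   has [{k alpha - p/q} = (d / q) {q_n alpha}].  Both directions lose only
   constant factors. *)

Require Import Defs.
From HB Require Import structures.
From mathcomp Require Import all_boot all_order all_algebra.
From mathcomp Require Import all_classical all_reals all_analysis.
From mathcomp Require Import zify ring lra.

Set Implicit Arguments.
Unset Strict Implicit.
Unset Printing Implicit Defensive.

Import Order.TTheory GRing.Theory Num.Theory.
Import numFieldNormedType.Exports.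

Local Open Scope classical_set_scope.
Local Open Scope ring_scope.

(** * Vanishing of a restricted liminf *)

(** Nonnegativity far out in [P] already bounds the liminf below by 0, so it only remains to find
    arbitrarily small values at arbitrarily large indices. For finite [P] both sides are false. *)
Lemma liminf_on_eq0P (R : realType) (P : set nat) (u : nat -> R) :
  (\forall n \near \oo, P n -> 0 <= u n) ->
  liminf_on P u = 0%E <->
  forall (e : R) (N : nat), 0 < e -> exists n, [/\ (N <= n)%N, P n & u n < e].
Proof.
move=> u_ge0; rewrite /liminf_on limf_einfE.
have infP (V : set nat) (e : R) : (forall n, V n -> e <= u n) ->
    (e%:E <= ereal_inf [set (u n)%:E | n in V])%E.
  by move=> Ve; apply: le_ereal_inf_tmp => _ [n Vn <-]; rewrite lee_fin Ve.
split=> [sup0 e N e_gt0 | small].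
  apply: contrapT => none.
  have: (e%:E <= 0)%E.
    rewrite -sup0; apply: le_trans (infP [set n | (N <= n)%N /\ P n] e _) _.
      move=> n [Nn Pn]; rewrite leNgt; apply/negP => un.
      by apply: none; exists n.
    by apply: ereal_sup_ubound; eexists; last reflexivity; exists N.
  by rewrite lee_fin leNgt e_gt0.
apply/eqP; rewrite eq_le; apply/andP; split.
  apply: ge_ereal_sup => _ [V [N _ PV] <-].
  apply/lee_addgt0Pr => e e_gt0; rewrite add0e.
  have [n [Nn Pn un]] := small e N e_gt0.
  apply: le_trans (_ : ((u n)%:E <= _)%E); last by rewrite lee_fin ltW.
  by apply: ereal_inf_lbound; exists n => //; apply: PV.
case: u_ge0 => N _ u_ge0.
apply: le_trans (infP [set n | (N <= n)%N /\ P n] 0 _) _.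
  by move=> n [Nn Pn]; apply: u_ge0.
by apply: ereal_sup_ubound; eexists; last reflexivity; exists N.
Qed.

Lemma sfrac_eq (R : realType) (x y : R) (m : int) :
  `|y| < 2^-1 -> x = y + m%:~R -> sfrac x = y.
Proof.
rewrite ltr_norml => /andP[y_gt y_lt] ->; apply/esym/sfracP.
by split; [exact: ltW | | exists m; rewrite addrAC subrr add0r].
Qed.

(** * Convergents and their approximation errors *)

Fixpoint cf_num (R : realType) (alpha : R) (n : nat) : int :=
  if n is n'.+1 then
    if n' is n''.+1 then
      cf_quot alpha n * cf_num alpha n' + cf_num alpha n''
    else cf_quot alpha 1 * cf_quot alpha 0 + 1
  else cf_quot alpha 0.

(** Since [q_n alpha - p_n] has sign [(-1)^n], this is its absolute value. *)
Definition cf_err (R : realType) (alpha : R) (n : nat) : R :=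
  (-1) ^+ n * ((cf_den alpha n)%:~R * alpha - (cf_num alpha n)%:~R).

Section ContinuedFraction.
Variables (R : realType) (alpha : R).
Hypothesis irr_alpha : irrational alpha.

Local Notation x_ := (cf_rem alpha).
Local Notation a_ := (cf_quot alpha).
Local Notation q_ := (cf_den alpha).
Local Notation p_ := (cf_num alpha).
Local Notation t_ := (cf_err alpha).

Lemma irrational_cf_rem n : irrational (x_ n).
Proof.
elim: n => [//|n IHn] /= [r _ rE]; apply: IHn.
exists (r^-1 + (a_ n)%:~R) => //.
by rewrite rmorphD fmorphV /= rE invrK ratr_int /cf_quot subrK.
Qed.

Lemma cf_rem_gt n : (a_ n)%:~R < x_ n.
Proof.
rewrite lt_neqAle floor_le_tmp andbT; apply/eqP => E.
by case: (@irrational_cf_rem n); exists (a_ n)%:~R; rewrite ?ratr_int.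
Qed.

Lemma cf_rem_gt1 n : 1 < x_ n.+1.
Proof.
have lt0 : 0 < x_ n - (a_ n)%:~R by rewrite subr_gt0 cf_rem_gt.
rewrite /= invf_gt1 // ltrBlDl -/(a_ n).
have := floorD1_gt (x_ n); rewrite intrD -/(a_ n); lra.
Qed.

Lemma cf_quot_ge1 n : 1 <= a_ n.+1.
Proof. by rewrite /cf_quot floor_ge_int_tmp ltW// cf_rem_gt1. Qed.

Lemma cf_denSS n : q_ n.+2 = a_ n.+2 * q_ n.+1 + q_ n.
Proof. by []. Qed.

Lemma cf_numSS n : p_ n.+2 = a_ n.+2 * p_ n.+1 + p_ n.
Proof. by []. Qed.

Lemma cf_den_ge n : n%:Z <= q_ n /\ 1 <= q_ n.
Proof.
suff : (n%:Z <= q_ n /\ 1 <= q_ n) /\ (n.+1%:Z <= q_ n.+1 /\ 1 <= q_ n.+1).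
  by case.
elim: n => [|n [[IHn IHn1] [IHSn IHSn1]]]; first by have := cf_quot_ge1 0.
split=> //; rewrite cf_denSS; have := cf_quot_ge1 n.+1; nia.
Qed.

Lemma cf_den_gt0 n : 0 < q_ n.
Proof. by have [_] := cf_den_ge n; apply: lt_le_trans. Qed.

Lemma cf_det n : p_ n.+1 * q_ n - p_ n * q_ n.+1 = (-1) ^+ n.
Proof.
elim: n => [|n IHn]; first by rewrite /=; ring.
by rewrite cf_numSS cf_denSS exprS -IHn; ring.
Qed.

Lemma coprime_cf_num_den n : coprimez (p_ n) (q_ n).
Proof.
apply/coprimezP; exists (- (-1) ^+ n * q_ n.+1, (-1) ^+ n * p_ n.+1) ; rewrite [LHS]/=.
transitivity ((-1) ^+ n * (p_ n.+1 * q_ n - p_ n * q_ n.+1)); first by ring.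
by rewrite cf_det -expr2 sqrr_sign.
Qed.

Lemma cf_errSS n : t_ n.+2 = t_ n - (a_ n.+2)%:~R * t_ n.+1.
Proof. by rewrite /cf_err cf_denSS cf_numSS !exprS !intrD !intrM; ring. Qed.

(** Complete quotients are ratios of consecutive errors: the recurrence of [t_] turns
    [t_n = t_(n+1) x_(n+2)] into [t_(n+2) = t_(n+1) (x_(n+2) - a_(n+2))], whose last factor is the
    inverse of [x_(n+3)]. As complete quotients of positive index exceed 1, the errors are positive
    and strictly decreasing. *)
Lemma cf_err_rem n : t_ n = t_ n.+1 * x_ n.+2.
Proof.
have remE m : (x_ m - (a_ m)%:~R) * x_ m.+1 = 1.
  by rewrite mulfV// gt_eqF// subr_gt0 cf_rem_gt.
elim: n => [|n IHn]; last first.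
  transitivity (t_ n.+1 * ((x_ n.+2 - (a_ n.+2)%:~R) * x_ n.+3)).
    by rewrite remE mulr1.
  by rewrite cf_errSS IHn; ring.
rewrite /cf_err expr0 expr1 [q_ 0]/= [p_ 0]/= [q_ 1]/= [p_ 1]/=.
rewrite [(1%Z)%:~R]mulr1z intrD intrM !mul1r.
have x0E := remE 0%N; rewrite -[x_ 0]/alpha in x0E *.
rewrite mulN1r [1%:~R]mulr1z.
have -> : - ((a_ 1)%:~R * alpha - ((a_ 1)%:~R * (a_ 0)%:~R + 1)) =
    (alpha - (a_ 0)%:~R) * (x_ 1 - (a_ 1)%:~R).
  by rewrite mulrBr x0E; ring.
by rewrite -mulrA remE mulr1.
Qed.

Lemma cf_err_gt0 n : 0 < t_ n.
Proof.
elim: n => [|n IHn]; last first.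
  by rewrite -(pmulr_lgt0 _ (lt_trans ltr01 (cf_rem_gt1 n.+1))) -cf_err_rem.
by rewrite /cf_err expr0 !mul1r subr_gt0 (cf_rem_gt 0).
Qed.

Lemma cf_err_lt (m n : nat) : (m < n)%N -> t_ n < t_ m.
Proof.
have ltS k : t_ k.+1 < t_ k.
  by rewrite [ltRHS]cf_err_rem ltr_pMr ?cf_err_gt0 ?cf_rem_gt1.
elim: n => // n IHn; rewrite ltnS leq_eqVlt => /predU1P[->//|/IHn].
exact/lt_trans.
Qed.

(** The determinant identity [cf_det] in terms of errors: the multiples of [alpha] cancel. *)
Lemma cf_err_den n : (q_ n.+1)%:~R * t_ n + (q_ n)%:~R * t_ n.+1 = 1.
Proof.
have /(congr1 (fun z : int => (-1) ^+ n * z%:~R : R)) := cf_det n.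
rewrite rmorphXn /= rmorphN1 -expr2 sqrr_sign => det.
rewrite -[RHS]det /cf_err exprS intrB !intrM.
by ring.
Qed.

(** Here [q_(n+1) t_n < 1] and [q_(n+1) >= 2]. Index 0 is excluded because [t_0] is the fractional
    part of [alpha], which may exceed one half. *)
Lemma cf_err_lt_half n : (0 < n)%N -> t_ n < 2^-1.
Proof.
case: n => // n _; have := cf_err_den n.+1; rewrite -(ltr_pM2l (x := 2)) //.
have : (2%:~R : R) <= (q_ n.+2)%:~R.
  rewrite ler_int; have := cf_den_ge n.+2; lia.
have : (0 : R) < (q_ n.+1)%:~R by rewrite ltr0z cf_den_gt0.
have := cf_err_gt0 n.+1; have := cf_err_gt0 n.+2; nra.
Qed.

Lemma sfrac_cf_den n : t_ n < 2^-1 ->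
  sfrac ((q_ n)%:~R * alpha) = (-1) ^+ n * t_ n.
Proof.
move=> t_lt; apply: (@sfrac_eq _ _ _ (p_ n)).
  by rewrite normrM normrX normrN1 expr1n mul1r ger0_norm ?ltW ?cf_err_gt0.
by rewrite /cf_err mulrA -expr2 sqrr_sign mul1r subrK.
Qed.

(** * Legendre's criterion *)

Lemma cf_den_itv (K : int) : 0 < K -> exists n, q_ n <= K < q_ n.+1.
Proof.
move=> K_gt0.
have exK : exists m, K < q_ m.
  by exists `|K|.+1; have := cf_den_ge `|K|.+1; lia.
case E: (ex_minn exK) => [|n]; move: E; case: ex_minnP => m.
  by move=> Km _ m0; move: Km; rewrite m0 /=; lia.
by move=> Km mmin mE; exists n; rewrite -mE Km andbT leNgt; apply/negP => /mmin; lia.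
Qed.

(* Between [q_n] and [q_(n+1)] the error [K alpha - P] is at least that of
   [q_n], so [K p_n - P q_n] is an integer of absolute value at most
   [2 K |K alpha - P| < 1]. *)
Lemma legendre (K P : int) : 0 < K ->
  K%:~R * `|K%:~R * alpha - P%:~R| < 2^-1 ->
  exists n (d : int), [/\ 0 < d, K = d * q_ n & P = d * p_ n].
Proof.
move=> K_gt0 Psmall; have [n /andP[qn_le qn_gt]] := cf_den_itv K_gt0.
exists n; set s : int := (-1) ^+ n.
have s2 : s * s = 1 by rewrite -expr2 sqrr_sign.
have det := cf_det n; rewrite -/s in det.
(* Coordinates of [(K, P)] in the basis of two consecutive convergents, integral because the
   determinant is a sign. *)
pose x := s * (K * p_ n.+1 - P * q_ n.+1).
pose y := s * (P * q_ n - K * p_ n).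
have KE : K = x * q_ n + y * q_ n.+1.
  transitivity (s * s * K); first by rewrite s2 mul1r.
  by rewrite -{2}det /x /y; ring.
have PE : P = x * p_ n + y * p_ n.+1.
  transitivity (s * s * P); first by rewrite s2 mul1r.
  by rewrite -{2}det /x /y; ring.
have sR : s%:~R * s%:~R = 1 :> R by rewrite -intrM s2.
have sE : s%:~R = (-1) ^+ n :> R by rewrite rmorphXn /= rmorphN1.
have errE : K%:~R * alpha - P%:~R = s%:~R * (x%:~R * t_ n - y%:~R * t_ n.+1) :> R.
  rewrite [in LHS]KE [in LHS]PE !intrD !intrM /cf_err exprS -sE.
  set z := LHS; transitivity (s%:~R * s%:~R * z); first by rewrite sR mul1r.
  by rewrite /z; ring.
have norms : `|s%:~R| = 1 :> R by rewrite sE normrX normrN1 expr1n.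
suff y0 : y = 0.
  exists x; move: KE PE; rewrite y0 !mul0r !addr0; split=> //.
  have := cf_den_gt0 n; nia.
have yE : y%:~R = (q_ n)%:~R * (- s%:~R * (K%:~R * alpha - P%:~R))
    + K%:~R * t_ n :> R.
  by rewrite /cf_err -sE /y !(intrM, intrB); ring.
(* The bounds [0 < K < q_(n+1)] force [x] and [y] to have opposite signs, so the two terms of [errE]
   add up and the error is at least [|x| t_n]. *)
have t_le : y != 0 -> t_ n <= `|K%:~R * alpha - P%:~R|.
  move=> y_neq0; rewrite errE normrM norms mul1r.
  have tn := cf_err_gt0 n; have tSn := cf_err_gt0 n.+1.
  have qn := cf_den_gt0 n; have qSn := cf_den_gt0 n.+1.
  have [y_gt0|y_le0] := ltP 0 y.
    have x_le : x <= -1 by nia.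
    rewrite ler0_norm; have : x%:~R <= -1 :> R by rewrite -(ler_int R) in x_le.
      have : 0 < y%:~R :> R by rewrite ltr0z.
      by nra.
    have : 0 < y%:~R :> R by rewrite ltr0z.
    by nra.
  have x_ge : 1 <= x by nia.
  have xR : 1 <= x%:~R :> R by rewrite -(ler_int R) in x_ge.
  have yR : y%:~R <= 0 :> R by rewrite lerz0.
  by rewrite ger0_norm; nra.
apply/eqP/contraT => y_neq0.
move: (t_ n) (cf_err_gt0 n) yE (t_le y_neq0) => t t_gt0 yE {}t_le.
have : 1 <= `|y%:~R| :> R by rewrite -intr_norm ler1z; lia.
rewrite leNgt yE => /negP; case.
apply: le_lt_trans (ler_normD _ _) _.
rewrite !normrM normrN norms mul1r (gtr0_norm t_gt0).
rewrite [`|K%:~R|]gtr0_norm ?[`|(q_ n)%:~R|]gtr0_norm ?ltr0z ?cf_den_gt0//.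
apply: le_lt_trans (_ : K%:~R * `|K%:~R * alpha - P%:~R| *+ 2 < 1); last first.
  by lra.
rewrite mulr2n; apply: lerD; first by rewrite ler_wpM2r ?ler_int.
by rewrite ler_wpM2l // ler0z ltW.
Qed.

(** * Transfer between inhomogeneous values and convergents *)

(** The boolean [s] treats both signs at once: [false] stands for positive errors and even [n],
    [true] for negative errors and odd [n]. *)
Lemma small_inhomogeneous_denominator (beta : R) (hbeta : 1 <= beta)
  (p : int) (q : nat) (hq : (0 < q)%N) (hpq : coprimez p q) (s : bool) :
  let x k := k%:R * alpha - p%:~R / q%:R in
  (forall (e : R) (N : nat), 0 < e -> exists k, [/\ (N <= k)%N,
     (0 < k)%N /\ 0 < (-1) ^+ s * sfrac (x k) &
     (-1) ^+ s * (k%:R `^ beta * sfrac (x k)) < e]) ->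
  forall (e : R) (N : nat), 0 < e -> exists n, [/\ (N <= n)%N,
     odd n = s /\ (q %| q_ n)%Z &
     (-1) ^+ s * ((q_ n)%:~R `^ beta * sfrac ((q_ n)%:~R * alpha)) < e].
Proof.
move=> x small e N e_gt0.
have q_gt0 : 0 < q%:R :> R by rewrite ltr0n.
have Q_gt0 : 0 < q%:R `^ beta * q%:R :> R by rewrite mulr_gt0 // powR_gt0.
have tN := cf_err_gt0 N.
(* The three thresholds give, in order, the final bound by [e], the hypothesis of [legendre]
   (through [k <= k^beta]), and [t_n < t_N]. The last makes [n] large, so no lower bound on [k] is
   requested. *)
have [|k [_ [k_gt0 d_gt0] k_small]] := small
  (Num.min (e / (q%:R `^ beta * q%:R))
           (Num.min (2^-1 / q%:R ^+ 2) (t_ N / q%:R))) 0.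
  by rewrite !lt_min !divr_gt0 // exprn_gt0.
have k_ge1 : 1 <= k%:R :> R by rewrite ler1n.
have kb := le1r_powR k_ge1 hbeta.
move: d_gt0 k_small; rewrite mulrCA; set dl := _ * sfrac _ => d_gt0.
rewrite !lt_min !ltr_pdivlMr ?exprn_gt0 // => /and3P[small_e small_half small_tN].
pose m := Num.floor (x k + 2^-1).
have dlE : dl = (-1) ^+ s * (x k - m%:~R) by [].
clearbody dl.
pose K : int := (q * k)%N; pose P : int := p + q%:Z * m.
have KR : K%:~R = q%:R * k%:R :> R by rewrite /K -pmulrn natrM.
have KPE : K%:~R * alpha - P%:~R = q%:R * ((-1) ^+ s * dl).
  rewrite dlE signrMK KR /P intrD intrM -pmulrn /x.
  by field; rewrite gt_eqF.
have normKP : `|K%:~R * alpha - P%:~R| = q%:R * dl.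
  by rewrite KPE !normrM normrX normrN1 expr1n mul1r !gtr0_norm.
have K_gt0 : 0 < K by rewrite /K ltz_nat muln_gt0 hq.
have [|n [d [d_pos KE PE]]] := @legendre K P K_gt0.
  rewrite normKP KR; apply: le_lt_trans small_half.
  rewrite [leLHS](_ : _ = k%:R * dl * q%:R ^+ 2); last by ring.
  by rewrite ler_pM2r ?exprn_gt0// ler_pM2r.
have tn := cf_err_gt0 n.
have dR : 1 <= d%:~R :> R by rewrite ler1z -gtz0_ge1.
have errE : (-1) ^+ s * ((-1) ^+ n * (d%:~R * t_ n)) = q%:R * dl.
  transitivity ((-1) ^+ s * (K%:~R * alpha - P%:~R)); last first.
    by rewrite KPE mulrCA signrMK.
  by congr (_ * _); rewrite KE PE !intrM /cf_err [d%:~R * _]mulrCA signrMK; ring.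
(* In [errE] the quantities [d], [t_n], [q] and [dl] are positive, so the two signs must agree. *)
have ns : odd n = s.
  apply/eqP/contraT => ns.
  have : (-1) ^+ s * (-1) ^+ n = -1 :> R.
    rewrite -[(-1) ^+ n]signr_odd -signr_addb.
    by clear -ns; case: s (odd n) ns => [] [].
  have : 0 < q%:R * dl by rewrite mulr_gt0.
  rewrite -errE mulrA => + E; rewrite E mulN1r oppr_gt0.
  by rewrite pmulr_rlt0 ?(lt_le_trans _ dR)// ltNge ltW.
have sn : (-1) ^+ n = (-1) ^+ s :> R by rewrite -signr_odd ns.
have dt : d%:~R * t_ n = q%:R * dl by rewrite -errE sn signrMK.
have t_le : t_ n <= q%:R * dl by rewrite -dt ler_peMl // ltW.
(* Strictness also yields [0 < n], which the half bound on [t_n] requires. *)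
have Nn : (N < n)%N.
  rewrite ltnNge; apply/negP => nN.
  have : t_ N <= t_ n.
    by move: nN; rewrite leq_eqVlt => /predU1P[->//|/cf_err_lt/ltW].
  rewrite leNgt => /negP; apply; apply: le_lt_trans t_le _.
  apply: le_lt_trans small_tN; rewrite mulrC ler_pM2r // ler_peMl ?(ltW d_gt0) //.
  exact: le_trans k_ge1 kb.
exists n; split; first exact: ltnW.
  (* [d] divides [P], which is congruent to [p] modulo [q]; hence [d] is prime to [q] and can be
     cancelled in [q | d q_n]. *)
  split=> //; rewrite -(@Gauss_dvdzr q d) -?KE; first by rewrite /K PoszM dvdz_mulr.
  have : coprimez P q.
    apply/coprimezP; have /coprimezP[[u v] /= uv] := hpq.
    by exists (u, v - u * m) => /=; rewrite -uv /P; ring.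
  by rewrite PE coprimezMl coprimez_sym => /andP[].
rewrite sfrac_cf_den ?cf_err_lt_half ?(leq_trans _ Nn)// sn mulrCA signrMK.
apply: le_lt_trans small_e.
rewrite [leRHS](_ : _ = (q%:R * k%:R) `^ beta * (q%:R * dl)); last first.
  by rewrite powRM ?ler0n//; ring.
apply: ler_pM; rewrite ?powR_ge0 ?(ltW tn)//.
have qn := cf_den_gt0 n.
rewrite -KR ge0_ler_powR ?nnegrE ?(le_trans _ hbeta) ?ler0z ?(ltW qn) ?(ltW K_gt0)//.
by rewrite ler_int KE ler_peMl ?(ltW qn) // -gtz0_ge1.
Qed.

Lemma small_cf_denominator (beta : R) (hbeta : 1 <= beta)
  (p : int) (q : nat) (hq : (0 < q)%N) (s : bool) :
  let x k := k%:R * alpha - p%:~R / q%:R in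
  (forall (e : R) (N : nat), 0 < e -> exists n, [/\ (N <= n)%N,
     odd n = s /\ (q %| q_ n)%Z &
     (-1) ^+ s * ((q_ n)%:~R `^ beta * sfrac ((q_ n)%:~R * alpha)) < e]) ->
  forall (e : R) (N : nat), 0 < e -> exists k, [/\ (N <= k)%N,
     (0 < k)%N /\ 0 < (-1) ^+ s * sfrac (x k) &
     (-1) ^+ s * (k%:R `^ beta * sfrac (x k)) < e].
Proof.
move=> x small e N e_gt0.
have q_gt0 : 0 < q%:R :> R by rewrite ltr0n.
(* As [q_n >= n > q N], the quotient [c = q_n / q] exceeds [N], and so does [k = d c]. *)
have [n [Nn [ns /dvdzP[c qnE]]]] := small e (q * N).+1 e_gt0.
have n_gt0 : (0 < n)%N by apply: leq_trans Nn.
have th := cf_err_lt_half n_gt0; have tn := cf_err_gt0 n.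
have sn : (-1) ^+ n = (-1) ^+ s :> R by rewrite -signr_odd ns.
rewrite sfrac_cf_den // sn mulrCA signrMK => small_e.
have [[u v] /= uv] := coprimezP _ _ (coprime_cf_num_den n).
(* [u] inverts [p_n] modulo [q_n], hence modulo [q]. Shifting by one picks the representative of
   [u p] in [[1, q]] rather than [[0, q - 1]], which keeps [k] and its error nonzero. *)
pose d := ((u * p - 1) %% q)%Z + 1.
have [d_ge1 d_le] : 1 <= d /\ d <= q%:Z.
  have q0 : q%:Z != 0 by lia.
  have := modz_ge0 (u * p - 1) q0.
  have := @ltz_pmod (u * p - 1) q; rewrite /d; lia.
(* This is [(d p_n - p) / q], which will be the integer nearest to [k alpha - p/q]. *)
pose w := (- v * c * p - ((u * p - 1) %/ q)%Z * p_ n).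
have dpE : d * p_ n - p = w * q.
  have dE : d = u * p - ((u * p - 1) %/ q)%Z * q.
    by have := divz_eq (u * p - 1) q; rewrite /d; lia.
  have -> : d * p_ n - p = d * p_ n - p * (u * p_ n + v * q_ n).
    by rewrite uv mulr1.
  by rewrite dE /w qnE; ring.
clearbody d w.
have c_gt0 : 0 < c by have := cf_den_gt0 n; rewrite qnE; nia.
have qn_ge := (cf_den_ge n).1.
have [k kE] : exists k : nat, k%:Z = d * c.
  by exists `|(d * c)%R|%N; rewrite gez0_abs //; nia.
have kR : k%:R = d%:~R * (q_ n)%:~R / q%:R :> R.
  by rewrite pmulrn kE qnE !intrM -pmulrn mulrA mulfK ?gt_eqF.
have Nk : (N < k)%N.
  have k_ge : c <= k%:Z by rewrite kE ler_peMl // ltW.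
  rewrite -ltz_nat (lt_le_trans _ k_ge) // -(ltr_pM2r (x := q%:Z)) // -qnE.
  by rewrite (lt_le_trans _ qn_ge) // mulrC -PoszM ltz_nat.
have dR1 : 1 <= d%:~R :> R by rewrite ler1z.
have dRq : d%:~R <= q%:R :> R by rewrite pmulrn ler_int.
have y_gt0 : 0 < d%:~R * t_ n / q%:R.
  by rewrite divr_gt0 // mulr_gt0 // (lt_le_trans ltr01).
have y_le : d%:~R * t_ n / q%:R <= t_ n.
  by rewrite ler_pdivrMr // mulrC ler_pM2l.
have sfE : sfrac (x k) = (-1) ^+ s * (d%:~R * t_ n / q%:R).
  apply: (@sfrac_eq _ _ _ w).
    rewrite normrM normrX normrN1 expr1n mul1r gtr0_norm//.
    exact: le_lt_trans th.
  have -> : w%:~R = (d%:~R * (p_ n)%:~R - p%:~R) / q%:R :> R.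
    by rewrite -intrM -intrB dpE intrM -pmulrn mulfK ?gt_eqF.
  rewrite /x kR /cf_err sn; set z := _ - (p_ n)%:~R.
  have -> : (-1) ^+ s * (d%:~R * ((-1) ^+ s * z) / q%:R) = d%:~R * z / q%:R.
    by rewrite -[z in RHS](signrMK s); ring.
  by rewrite /z; field; rewrite gt_eqF.
exists k; split.
- exact: ltnW.
- split; first exact: leq_ltn_trans Nk.
  by rewrite sfE signrMK.
rewrite sfE mulrCA signrMK.
apply: le_lt_trans small_e; apply: ler_pM; rewrite ?powR_ge0 ?(ltW y_gt0)//.
have qn := cf_den_gt0 n.
rewrite ge0_ler_powR ?nnegrE ?(le_trans _ hbeta) ?ler0z ?(ltW qn)//.
rewrite kR ler_pdivrMr // mulrC ler_pM2l ?ltr0z//.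
Qed.

End ContinuedFraction.

(** * The equivalence for both signs *)

Theorem theorem1p2 (R : realType) (beta : R) (hbeta : 1 <= beta)
  (alpha : R) (halpha : irrational alpha)
  (p : int) (q : nat) (hq : (0 < q)%N) (hpq : coprimez p q) :
  (mu_plus alpha beta (p%:~R / q%:R) = 0%E <->
   liminf_on [set n : nat | (q %| cf_den alpha (2 * n))%Z]
     (fun n => (cf_den alpha (2 * n))%:~R `^ beta *
               sfrac ((cf_den alpha (2 * n))%:~R * alpha)) = 0%E)
  /\
  (mu_minus alpha beta (p%:~R / q%:R) = 0%E <->
   liminf_on [set n : nat | (0 < n)%N /\ (q %| cf_den alpha (2 * n - 1))%Z]
     (fun n => - ((cf_den alpha (2 * n - 1))%:~R `^ beta *
                  sfrac ((cf_den alpha (2 * n - 1))%:~R * alpha))) = 0%E).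
Proof.
have toL (s : bool) := small_inhomogeneous_denominator halpha hbeta hq hpq (s := s).
have toR (s : bool) := small_cf_denominator halpha hbeta p hq (s := s).
have val_ge0 n : (0 < n)%N ->
    0 <= (-1) ^+ n * ((cf_den alpha n)%:~R `^ beta *
                      sfrac ((cf_den alpha n)%:~R * alpha)).
  move=> n_gt0; rewrite sfrac_cf_den ?cf_err_lt_half // mulrCA.
  by rewrite signrMK mulr_ge0 ?powR_ge0 // ltW // cf_err_gt0.
split; rewrite /mu_plus /mu_minus !liminf_on_eq0P.
- split=> [small|small] e N e_gt0.
  + have [f M f_gt0|n [Nn [n_even qn] un]] := toL false _ e (2 * N)%N e_gt0.
      have [k [Mk [k_gt0 xk] uk]] := small f M f_gt0.
      by exists k; rewrite expr0 !mul1r.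
    (* Parity of [n] recovers it from its half; asking for [n >= 2 N] makes the half at least
       [N]. *)
    exists n./2; have nE : (2 * n./2)%N = n by lia.
    rewrite /= nE; split=> //; first by lia.
    by move: un; rewrite expr0 mul1r.
  + have [f M f_gt0|k [Nk [k_gt0 xk] uk]] := toR false _ e N e_gt0.
      have [n [Mn qn un]] := small f M f_gt0.
      exists (2 * n)%N; rewrite expr0 mul1r; split=> //; first by lia.
      by split=> //; lia.
    by move: xk uk; rewrite expr0 !mul1r => xk uk; exists k.
(* Index 0 is skipped: [q_0 = 1], and [sfrac alpha] may be negative. *)
- exists 1%N => // n /= n_gt0 _.
  have := @val_ge0 (2 * n)%N; rewrite -signr_odd mul2n odd_double expr0 mul1r.
  by apply; rewrite double_gt0.
- by apply: nearW => k [_ xk]; rewrite mulr_ge0 ?powR_ge0 // ltW.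
- split=> [small|small] e N e_gt0.
  + have [f M f_gt0|n [Nn [n_odd qn] un]] := toL true _ e (2 * N)%N e_gt0.
      have [k [Mk [k_gt0 xk] uk]] := small f M f_gt0.
      by exists k; rewrite expr1 !mulN1r oppr_gt0.
    exists n./2.+1; have nE : (2 * n./2.+1 - 1)%N = n by lia.
    rewrite /= nE; split=> //; first by lia.
    by move: un; rewrite expr1 mulN1r.
  + have [f M f_gt0|k [Nk [k_gt0 xk] uk]] := toR true _ e N e_gt0.
      have [n [Mn [n_gt0 qn] un]] := small f M.+1 f_gt0.
      exists (2 * n - 1)%N; rewrite expr1 mulN1r; split=> //; first by lia.
      by split=> //; lia.
    by move: xk uk; rewrite expr1 !mulN1r oppr_gt0 => xk uk; exists k.
- exists 1%N => // n /= n_gt0 _.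
  have := @val_ge0 (2 * n - 1)%N; rewrite -signr_odd.
  have -> : odd (2 * n - 1) by lia.
  by rewrite expr1 mulN1r; apply; lia.
- apply: nearW => k [_ xk]; rewrite -mulrN mulr_ge0 ?powR_ge0 //.
  by rewrite oppr_ge0 ltW.
Qed.
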